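(* For every integer $e\geq 1$, with $q=2^{2e+1}$, the graph $\mathcal{G}_q(V,E)$ constructed from the Suzuki group $Sz(q)$ is an edge-girth-regular graph of girth five.
   Context: All graphs are simple. An $egr(v,k,g,\lambda)$, or edge-girth-regular graph, is a $k$-regular graph of order (number of vertices) $v$ and girth $g$ such that each of its edges is contained in exactly $\lambda$ distinct $g$-cycles. A graph is edge-girth-regular (an egr-graph) if it is an $egr(v,k,g,\lambda)$ for some $v,k,g,\lambda$. Construction of $\mathcal{G}_q(V,E)$. Let $q=2^{2e+1}$ with $e$ a strictly positive integer, and let $G\cong Sz(q)$ be the Suzuki group in its natural (2-transitive) action on the Suzuki–Tits ovoid $\mathcal{D}$ of $PG(3,q)$, which has $q^2+1$ points. A circle of $\mathcal{D}$ is the intersection of $\mathcal{D}$ with a plane of $PG(3,q)$ meeting $\mathcal{D}$ in more than one point. Let $G_1\cong E_q:C_{q-1}$ be the stabilizer in $G$ of a circle of $\mathcal{D}$ ($E_q$ is an elementary abelian group of order $q$, $C_{q-1}$ a cyclic group of order $q-1$). The orbits of $G_1$ on $\mathcal{D}$ have sizes $1$, $q$ and $q^2-q$; the point $n$ forming the orbit of size $1$ is called the nucleus of the circle. Pick a point $p$ in the orbit of size $q$, and let $G_2$ be the setwise stabilizer of $\{n,p\}$ in $G$. Then $G_2\cong D_{2(q-1)}$ (dihedral of order $2(q-1)$) and $G_1\cap G_2\cong C_{q-1}$ has index $2$ in $G_2$. The graph $\mathcal{G}_q(V,E)$ has as vertex set $V$ the set of right cosets $G_1g$ ($g\in G$)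 and as edge set $E$ the set of right cosets $G_2h$ ($h\in G$); the vertex $G_1g$ is on the edge $G_2h$ if and only if $G_1g\cap G_2h\neq\emptyset$ (each edge contains exactly two vertices). *)

(* Defs.v *)
From mathcomp Require Import all_boot all_order all_fingroup all_algebra.
From mathcomp Require Import all_solvable.
From mathcomp Require Import mxrepresentation mxabelem.

Set Implicit Arguments.
Unset Strict Implicit.
Unset Printing Implicit Defensive.

Import GroupScope GRing.Theory.
Local Open Scope group_scope.

(* Vertices and edges are abstract finite sets related by incidence, as in a
   coset geometry; such a structure may a priori have loops or parallel edges,
   and is_simple excludes them. *)
Record incidence_graph (TV TE : finType) := IncidenceGraph {
  vertices : {set TV};
  edges : {set TE};
  on_edge : TV -> TE -> bool }.

Section Graphs.

Variables (TV TE : finType) (X : incidence_graph TV TE).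

Definition ends (f : TE) : {set TV} := [set u in vertices X | on_edge X u f].

Definition is_simple : Prop :=
  (forall f, f \in edges X -> #|ends f| = 2%N) /\ {in edges X &, injective ends}.

Definition adjacent : rel TV := fun u w =>
  (u != w) && [exists f in edges X, ends f == [set u; w]].

Definition degree (u : TV) : nat := #|[set f in edges X | on_edge X u f]|.

Definition cycle_edges (s : seq TV) : {set TE} :=
  [set f in edges X | [exists u in s, ends f == [set u; next s u]]].

(* A cycle is a subgraph, hence is identified with its set of edges: the
   cyclic sequences obtained by rotation or reversal give the same cycle. *)
Definition cycles_of_length (m : nat) : {set {set TE}} :=
  [set cycle_edges s | s : m.-tuple TV
     & [&& (3 <= m)%N, uniq s & path.cycle adjacent s]].

Definition has_girth (g : nat) : Prop :=
  cycles_of_length g != set0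
  /\ forall m, cycles_of_length m != set0 -> (g <= m)%N.

Definition egr (v k g lambda : nat) : Prop :=
  [/\ is_simple,
      #|vertices X| = v,
      forall u, u \in vertices X -> degree u = k,
      has_girth g
    & forall f, f \in edges X ->
        #|[set Z in cycles_of_length g | f \in Z]| = lambda].

Definition edge_girth_regular : Prop := exists v k g lambda, egr v k g lambda.

End Graphs.

Definition coset_graph (gT : finGroupType) (G G1 G2 : {set gT}) :
    incidence_graph {set gT} {set gT} :=
  IncidenceGraph (rcosets G1 G) (rcosets G2 G)
    (fun u f => u :&: f != set0).

Section Suzuki.

Variables (e : nat) (F : finFieldType).

(* For #|F| = 2 ^ (2 * e + 1) this is the field automorphism whose square is
   the Frobenius map x |-> x ^ 2. *)
Definition theta (x : F) : F := (x ^+ (2 ^ e.+1))%R.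

Definition mx4 (rows : seq (seq F)) : 'M[F]_4 :=
  (\matrix_(i < 4, j < 4) nth 0 (nth [::] rows i) j)%R.

Definition rv4 (x0 x1 x2 x3 : F) : 'rV[F]_4 :=
  (\row_(j < 4) nth 0 [:: x0; x1; x2; x3] j)%R.

Definition suzuki_unipotent (a b : F) : 'M[F]_4 := (mx4
  [:: [:: 1; 0; 0; 0];
      [:: a; 1; 0; 0];
      [:: b; theta a; 1; 0];
      [:: a ^+ 2 * theta a + a * b + theta b; a * theta a + b; a; 1]])%R.

Definition suzuki_torus (c : F) : 'M[F]_4 := (mx4
  [:: [:: c ^+ (1 + 2 ^ e); 0; 0; 0];
      [:: 0; c ^+ (2 ^ e); 0; 0];
      [:: 0; 0; c ^- (2 ^ e); 0];
      [:: 0; 0; 0; c ^- (1 + 2 ^ e)]])%R.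

Definition suzuki_involution : 'M[F]_4 := (mx4
  [:: [:: 0; 0; 0; 1];
      [:: 0; 0; 1; 0];
      [:: 0; 1; 0; 0];
      [:: 1; 0; 0; 0]])%R.

(* Suzuki's original matrix group (generators as in Huppert-Blackburn,
   Finite Groups III, XI.3), acting on row vectors from the right.  It contains
   no nontrivial scalar matrix, so it acts faithfully on PG(3, q). *)
Definition Sz : {group {'GL_4[F]}} :=
  <<[set g : {'GL_4[F]} |
      [|| [exists a, exists b, GLval g == suzuki_unipotent a b],
          [exists c, (c != 0%R) && (GLval g == suzuki_torus c)]
        | GLval g == suzuki_involution]]>>%G.

(* A subspace of PG(3, q) is the set of row vectors of a subspace of F^4; in
   particular the point spanned by v != 0 is rowg v. *)
Definition point_action : action 'GL_4[F] {set 'rV[F]_4} :=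
  ('MR (GLrepr F 3))^*%act.

Definition ovoid : {set {set 'rV[F]_4}} :=
  rowg (rv4 1 0 0 0)%R |:
    [set rowg (rv4 (x * y + x ^+ 2 * theta x + theta y) y x 1)%R
       | x : F, y : F].

Definition plane_section (W : 'M[F]_4) : {set {set 'rV[F]_4}} :=
  [set P in ovoid | P \subset rowg W].

Definition is_circle (C : {set {set 'rV[F]_4}}) : Prop :=
  exists W : 'M[F]_4, [/\ \rank W = 3%N, C = plane_section W & (1 < #|C|)%N].

Definition circle_stab (C : {set {set 'rV[F]_4}}) : {set {'GL_4[F]}} :=
  'N_Sz(C | point_action).

Definition is_nucleus (C : {set {set 'rV[F]_4}}) (n : {set 'rV[F]_4}) : Prop :=
  n \in ovoid /\ #|orbit point_action (circle_stab C) n| = 1%N.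

Definition pair_stab (n p : {set 'rV[F]_4}) : {set {'GL_4[F]}} :=
  'N_Sz([set n; p] | point_action).

Definition suzuki_graph (C : {set {set 'rV[F]_4}}) (n p : {set 'rV[F]_4}) :=
  coset_graph Sz (circle_stab C) (pair_stab n p).

End Suzuki.

(* Main.v *)
Require Import Defs.
From mathcomp Require Import all_boot all_order all_fingroup all_algebra.
From mathcomp Require Import finfield mxrepresentation mxabelem ring.

(** The Suzuki group acts on the graph by right multiplication, transitively on
    vertices and on edges.  Hence the degree and the number of 5-cycles through
    an edge are constant for free ([pentagonal_pair_girth5]), and the content of
    the theorem is that the girth is five.

    A vertex is a circle, an edge is a pair of points of the ovoid, and the edge
    {P, Q} joins the circle through Q with nucleus P to the circle through P with
    nucleus Q.  Let G1 be the stabilizer of a base circle, o the chosen point of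
    that circle, and w an involution of the group that exchanges o and the
    nucleus.  Walks that start at the base circle are the cosets
    G1, G1 w x1, G1 w x2 w x1, ... with all xi in G1, so a closed walk of length
    m is a word of that shape lying in G1.  The conditions that make short words
    behave are collected in [pentagonal_pair]: words of length three or four that
    lie in G1 must backtrack, and some word of length five does close up.

    The normal form is as follows.  The nucleus is the point at infinity
    <(1,0,0,0)>, the base circle consists of it and of the points
    <(theta y, y, 0, 1)>, the point o is <(0,0,0,1)>, and w reverses coordinates.
    An element x of G1 fixes infinity and sends o to some <(theta b, b, 0, 1)>,
    where b = 0 exactly when w x w is again in G1.  Comparing the images of
    infinity under two halves of a closed word then gives a coordinate identity
    which forces b = 0 for one of the letters ([G1_triangle], [G1_square]).  A
    pentagon is supplied by the element w U(0,1), which has order five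
    ([wU_pow5]); it already lives in Sz(2).

    What must be known about the group itself comes from one invariant.  The
    points infinity.g carry a spread of lines (the Lueneburg spread), and the
    line of infinity.g is spanned by the first two rows of g.  Four of its
    Pluecker coordinates are the theta-images of the coordinates of the point, and
    the other two agree ([Sz_minors]); this is checked on generators.  The Pluecker relations then
    place infinity.g on the ovoid, and the invariant shows that an element fixing
    infinity and o maps the base circle to itself ([two_point_stab]), so that an
    edge of the coset graph has exactly two ends and is determined by them.

    Finally, any circle is an image of the base circle ([circle_normal]), because
    x ^ 2 * theta x is a bijection of the field; the orbit sizes given for the
    nucleus and for p identify them with infinity and, up to the stabilizer of
    the circle, with o ([suzuki_flag_normal]). *)

(** * Automorphisms of incidence graphs *)

Section Automorphisms.

Set Implicit Arguments.
Unset Strict Implicit.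
Import GroupScope.

Record graph_automorphism (TV TE : finType) (X : incidence_graph TV TE)
    (a : TV -> TV) (b : TE -> TE) : Prop := GraphAutomorphism {
  aut_vertex_inj : injective a;
  aut_edge_inj : injective b;
  aut_vertices : forall u, (a u \in vertices X) = (u \in vertices X);
  aut_edges : forall f, (b f \in edges X) = (f \in edges X);
  aut_on_edge : forall u f, on_edge X (a u) (b f) = on_edge X u f }.

Variables (TV TE : finType) (X : incidence_graph TV TE).
Variables (a : TV -> TV) (b : TE -> TE).
Hypothesis autX : graph_automorphism X a b.

Let inja := aut_vertex_inj autX.
Let injb := aut_edge_inj autX.

Lemma ends_aut f : ends X (b f) = a @: ends X f.
Proof.
have [a' aK a'K] := injF_bij inja; apply/setP => u.
rewrite -[u]a'K (mem_imset _ _ inja) !inE.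
by rewrite (aut_vertices autX) (aut_on_edge autX).
Qed.

Lemma adjacent_aut u w : adjacent X (a u) (a w) = adjacent X u w.
Proof.
have [b' bK b'K] := injF_bij injb.
rewrite /adjacent (inj_eq inja); congr (_ && _).
apply/exists_inP/exists_inP => -[f fX /eqP eq_f]; last first.
  exists (b f); first by rewrite (aut_edges autX).
  by rewrite ends_aut eq_f imsetU1 imset_set1.
exists (b' f); first by rewrite -(aut_edges autX) b'K.
rewrite -(inj_eq (imset_inj inja)) -ends_aut b'K eq_f.
by rewrite imsetU1 imset_set1.
Qed.

Lemma degree_aut u : degree X (a u) = degree X u.
Proof.
have [b' bK b'K] := injF_bij injb.
rewrite /degree -[RHS](card_imset _ injb); apply: eq_card => f.
rewrite -[f]b'K (mem_imset _ _ injb) !inE.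
by rewrite (aut_edges autX) (aut_on_edge autX).
Qed.

Lemma cycle_edges_aut s :
  uniq s -> cycle_edges X (map a s) = b @: cycle_edges X s.
Proof.
have [b' bK b'K] := injF_bij injb.
move=> Us; apply/setP => f; rewrite -[f]b'K (mem_imset _ _ injb) !inE.
rewrite (aut_edges autX); congr (_ && _); set h := b' f.
have eq_ends u : (ends X (b h) == [set a u; next (map a s) (a u)])
    = (ends X h == [set u; next s u]).
  rewrite next_map // ends_aut -[RHS](inj_eq (imset_inj inja)) imsetU1.
  by rewrite imset_set1.
apply/exists_inP/exists_inP => -[u us].
  by case/mapP: us => v vs ->; rewrite eq_ends; exists v.
by exists (a u); [apply: map_f | rewrite eq_ends].
Qed.

Lemma cycles_of_length_aut m Z :
  Z \in cycles_of_length X m -> b @: Z \in cycles_of_length X m.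
Proof.
case/imsetP => s; rewrite inE => /and3P[m_ge3 Us cs] ->.
rewrite -cycle_edges_aut //; apply/imsetP; exists (map_tuple a s) => //.
rewrite inE m_ge3 /= map_inj_uniq // Us cycle_map.
by rewrite (eq_cycle (e' := adjacent X)) // => u w; apply: adjacent_aut.
Qed.

(** Only the inequality is stated: for the graph below the inverse of an
    automorphism is one of the same family, which gives the converse. *)
Lemma leq_cycles_through_aut m f :
  #|[set Z in cycles_of_length X m | f \in Z]|
    <= #|[set Z in cycles_of_length X m | b f \in Z]|.
Proof.
rewrite -(card_imset _ (imset_inj injb)); apply/subset_leq_card/subsetP => Z'.
case/imsetP => Z; rewrite inE => /andP[cZ fZ] ->.
by rewrite inE cycles_of_length_aut //= imset_f.
Qed.

End Automorphisms.

(** * Coset graphs of girth five *)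

Section CosetGraph.

Set Implicit Arguments.
Unset Strict Implicit.
Import GroupScope.

(** Under these conditions the coset graph of G1 and G2 in G is simple, regular
    and edge-transitive of girth five.  The element t exchanges the two ends of
    the base edge.  For x in G1, the condition t x t \in G1 says that the step of
    a walk with letter x undoes the preceding step; so the fields about triangles
    and squares say that a closed walk of length three or four backtracks. *)
Record pentagonal_pair (gT : finGroupType) (G G1 G2 : {set gT}) (t : gT) :
    Prop := PentagonalPair {
  pp_sub1 : G1 \subset G;
  pp_sub2 : G2 \subset G;
  pp_t : t \in G2;
  pp_tG1 : t \notin G1;
  pp_tt : t * t = 1;
  pp_index : {in G2, forall x, (x \in G1) || (x * t \in G1)};
  pp_meet : {in G1, forall x, t * x * t \in G1 -> x \in G2};
  pp_triangle : {in G1 &, forall x y,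
    t * x * t * y * t \in G1 -> t * x * t \in G1};
  pp_square : {in G1 & &, forall x y z,
    t * x * t * y * t * z * t \in G1 ->
    (t * x * t \in G1) || (t * y * t \in G1)};
  pp_pentagon : exists2 x, x \in G1 & (t * x) ^+ 5 = 1 }.

Variables (gT : finGroupType) (G G1 G2 : {group gT}) (t : gT).
Hypothesis ppG : pentagonal_pair G G1 G2 t.

Let sG1 := subsetP (pp_sub1 ppG).
Let sG2 := subsetP (pp_sub2 ppG).
Let tG1 := pp_tG1 ppG.
Let tt := pp_tt ppG.
Let tG : t \in G. Proof. exact: sG2 (pp_t ppG). Qed.
Let tV : t^-1 = t. Proof. by apply/eqP; rewrite eq_invg_mul tt. Qed.
Let ttK x : t * (t * x) = x. Proof. by rewrite mulgA tt mul1g. Qed.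

Local Notation X := (coset_graph G G1 G2).

Lemma rcosetE_in (H : {group gT}) x g : x \in H -> H :* (x * g) = H :* g.
Proof. by move=> xH; rewrite rcosetM rcoset_id. Qed.

Lemma ends_coset h : h \in G ->
  ends X (G2 :* h) = [set G1 :* h; G1 :* (t * h)].
Proof.
move=> hG; apply/setP => u; rewrite !inE.
apply/andP/orP => [[/rcosetsP[g gG ->]] | ].
  case/set0Pn => x /setIP[/rcoset_eqP <- /rcosetP[y yG2 ->]].
  case/orP: (pp_index ppG yG2) => yG1; [left | right].
    by rewrite rcosetE_in.
  by rewrite -{1}[h]ttK mulgA rcosetE_in.
case=> /eqP ->; split; try by apply/rcosetsP; eexists; last by []; rewrite ?groupM.
  by apply/set0Pn; exists h; rewrite !inE !rcoset_refl.
apply/set0Pn; exists (t * h); rewrite inE rcoset_refl.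
by rewrite mem_rcoset mulgK (pp_t ppG).
Qed.

Lemma rcoset_t_neq h : G1 :* h != G1 :* (t * h).
Proof.
by apply: contra tG1 => /eqP/esym/rcoset_eqP; rewrite mem_rcoset mulgK.
Qed.


Lemma coset_graph_simple : is_simple X.
Proof.
split=> [_ /rcosetsP[h hG ->] | _ _ /rcosetsP[h hG ->] /rcosetsP[k kG ->]].
  by rewrite ends_coset // cards2 rcoset_t_neq.
rewrite !ends_coset // => eq_hk; apply/rcoset_eqP.
have same_edge l : G1 :* h = G1 :* l -> G1 :* (t * h) = G1 :* (t * l) ->
    h \in G2 :* l.
  move=> /rcoset_eqP + /rcoset_eqP; rewrite !mem_rcoset => hl.
  rewrite invMg tV !mulgA -(mulgA t h).
  exact: (pp_meet ppG).
have: G1 :* h \in [set G1 :* k; G1 :* (t * k)] by rewrite -eq_hk set21.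
have: G1 :* (t * h) \in [set G1 :* k; G1 :* (t * k)] by rewrite -eq_hk set22.
have neq_h := rcoset_t_neq h; rewrite !in_set2.
case/orP=> /eqP eq_th /orP[] /eqP eq_h; first by rewrite eq_h eq_th eqxx in neq_h.
- suff: h \in G2 :* (t * k) by rewrite rcosetE_in ?(pp_t ppG).
  by apply: same_edge; rewrite ?ttK.
- exact: same_edge.
- by rewrite eq_h eq_th eqxx in neq_h.
Qed.

Lemma adjacent_vertex u w : adjacent X u w -> u \in rcosets G1 G.
Proof.
case/andP=> _ /exists_inP[f _ /eqP eq_f].
by have := set21 u w; rewrite -eq_f inE => /andP[].
Qed.

(** The neighbours of G1 g are the cosets G1 t x g with x in G1: the edge through
    G1 g and v is G2 h with h or t h in G1 g, and v is then the other end. *)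
Lemma adjacent_coset g v : g \in G -> adjacent X (G1 :* g) v ->
  exists2 x, x \in G1 & v = G1 :* (t * x * g).
Proof.
move=> gG /andP[neq_v /exists_inP[f /rcosetsP[h hG ->]]].
rewrite ends_coset // => /eqP eq_hv.
have: v \in [set G1 :* h; G1 :* (t * h)] by rewrite eq_hv set22.
have: G1 :* g \in [set G1 :* h; G1 :* (t * h)] by rewrite eq_hv set21.
rewrite !in_set2 => /orP[] /eqP eq_g /orP[] /eqP eq_v; move: neq_v;
  rewrite eq_g eq_v ?eqxx // => _.
- have /rcosetP[x xG1 ->]: h \in G1 :* g by rewrite eq_g rcoset_refl.
  by exists x; rewrite // mulgA.
- have /rcosetP[x xG1 eq_h]: t * h \in G1 :* g by rewrite eq_g rcoset_refl.
  by exists x; rewrite // -mulgA -eq_h ttK.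
Qed.

Lemma coset_adjacent g x : g \in G -> x \in G1 ->
  adjacent X (G1 :* g) (G1 :* (t * x * g)).
Proof.
move=> gG xG1; have xgG : x * g \in G by rewrite groupM ?(sG1 xG1).
rewrite -(rcosetE_in g xG1) -mulgA; apply/andP; split; first exact: rcoset_t_neq.
apply/exists_inP; exists (G2 :* (x * g)); first by apply/rcosetsP; exists (x * g).
by rewrite ends_coset.
Qed.

Lemma rcoset_loop x g : G1 :* g = G1 :* (x * g) -> x \in G1.
Proof. by move/esym/rcoset_eqP; rewrite mem_rcoset mulgK. Qed.

(** Backtracking: for y in G1, the letters y and then x lead from G1 h to the
    left-hand side, and the right-hand side is G1 h again. *)
Lemma rcoset_back x y h : t * x * t \in G1 ->
  G1 :* (t * x * (t * y * h)) = G1 :* (y * h).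
Proof. by move=> txtG1; rewrite -(mulgA t y) (mulgA (t * x)) rcosetE_in. Qed.

Lemma coset_graph_no_triangle : cycles_of_length X 3 = set0.
Proof.
apply/setP => Z; rewrite inE; apply/imsetP => -[[[|a [|b [|c []]]] // s3]].
rewrite inE => /and3P[_ /= Us /and4P[adj_ab adj_bc adj_ca _] _].
have neq_ab: a != b by case/andP: adj_ab.
have /rcosetsP[g gG eq_a] := adjacent_vertex adj_ab.
move: adj_ab; rewrite eq_a => /(adjacent_coset gG)[x xG1 eq_b].
have mG1 y h : y \in G1 -> h \in G -> t * y * h \in G.
  by move=> /sG1 yG hG; rewrite !groupM.
move: adj_bc; rewrite eq_b => /adjacent_coset[|y yG1 eq_c]; first exact: mG1.
move: adj_ca; rewrite eq_c => /adjacent_coset[|z zG1]; first by rewrite !mG1.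
move=> eq_a'; have := eq_a'; rewrite {1}eq_a !mulgA => /rcoset_loop.
rewrite groupMr // => /(pp_triangle ppG zG1 yG1) tztG1.
by case/eqP: neq_ab; rewrite eq_a' eq_b rcoset_back // rcosetE_in.
Qed.

Lemma coset_graph_no_square : cycles_of_length X 4 = set0.
Proof.
apply/setP => Z; rewrite inE; apply/imsetP => -[[[|a [|b [|c [|d []]]]] // s4]].
rewrite inE => /and3P[_ /= Us /and5P[adj_ab adj_bc adj_cd adj_da _] _].
have [neq_ac neq_bd] : a != c /\ b != d.
  by move: Us; rewrite !inE !negb_or => /and3P[/and3P[_ -> _] /andP[_ ->]].
have /rcosetsP[g gG eq_a] := adjacent_vertex adj_ab.
move: adj_ab; rewrite eq_a => /(adjacent_coset gG)[x xG1 eq_b].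
have mG1 y h : y \in G1 -> h \in G -> t * y * h \in G.
  by move=> /sG1 yG hG; rewrite !groupM.
move: adj_bc; rewrite eq_b => /adjacent_coset[|y yG1 eq_c]; first exact: mG1.
move: adj_cd; rewrite eq_c => /adjacent_coset[|z zG1 eq_d]; first by rewrite !mG1.
move: adj_da; rewrite eq_d => /adjacent_coset[|v vG1]; first by rewrite !mG1.
move=> eq_a'; have := eq_a'; rewrite {1}eq_a !mulgA => /rcoset_loop.
rewrite groupMr // => /(pp_square ppG vG1 zG1 yG1)/orP[tvtG1 | tztG1].
  by case/eqP: neq_ac; rewrite eq_a' eq_c rcoset_back // rcosetE_in.
by case/eqP: neq_bd; rewrite eq_d eq_b rcoset_back // (rcosetE_in _ yG1).
Qed.

Lemma coset_graph_pentagon : cycles_of_length X 5 != set0.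
Proof.
have [x xG1 ex5] := pp_pentagon ppG; set y := t * x in ex5.
have yG : y \in G by rewrite groupM ?(sG1 xG1).
have yG1 : y \notin G1 by rewrite groupMr.
pose v i := G1 :* y ^+ i.
have adj_v i : adjacent X (v i) (v i.+1).
  by rewrite /v expgS coset_adjacent ?groupX.
(* As 5 is prime, a power of y with exponent 1 to 4 generates <[y]>; if it
     lay in G1, so would y. *)
have neq_v i j : i < j < 5 -> v i != v j.
  case/andP=> lt_ij lt_j5; apply: contra yG1 => /eqP.
  rewrite /v -(subnK (ltnW lt_ij)) expgD => /rcoset_loop.
  have {lt_ij}: 0 < j - i by rewrite subn_gt0.
  have {lt_j5}: j - i < 5 by apply: leq_ltn_trans lt_j5; apply: leq_subr.
  have pow k : y ^+ (5 * k + 1) = y by rewrite expgD expgM ex5 expg1n mul1g.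
  case: (j - i) => [|[|[|[|[|//]]]]] // _ _ yk.
  - by rewrite -(pow 1%N) (expgM y 2 3) groupX.
  - by rewrite -(pow 1%N) (expgM y 3 2) groupX.
  - by rewrite -(pow 3) (expgM y 4 4) groupX.
have v50 : v 5 = v 0 by rewrite /v ex5.
apply/set0Pn; exists (cycle_edges X [:: v 0; v 1%N; v 2; v 3; v 4]).
apply/imsetP; exists [tuple v 0; v 1%N; v 2; v 3; v 4] => //.
rewrite inE /= !inE !negb_or !neq_v // !adj_v /=.
by rewrite -v50 adj_v.
Qed.

Lemma coset_graph_girth : has_girth X 5.
Proof.
split=> [|m /set0Pn[Z Zm]]; first exact: coset_graph_pentagon.
have m_ge3 : 2 < m by case/imsetP: Zm => s; rewrite inE => /andP[].
rewrite leqNgt; apply/negP => m_lt5.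
have /orP[/eqP m_eq|/eqP m_eq] : (m == 3) || (m == 4).
  by case: m m_ge3 m_lt5 Zm => [|[|[|[|[]]]]].
  by rewrite m_eq coset_graph_no_triangle inE in Zm.
by rewrite m_eq coset_graph_no_square inE in Zm.
Qed.

Lemma coset_graph_aut g : g \in G ->
  graph_automorphism X (fun u => u :* g) (fun f => f :* g).
Proof.
move=> gG; have injR : injective (fun A : {set gT} => A :* g) := can_inj (rcosetK g).
have mem_rcosetsR H u : (u :* g \in rcosets H G) = (u \in rcosets H G).
  rewrite -[u](rcosetK g) rcosetKV; apply/rcosetsP/rcosetsP => -[x xG].
    by move=> ->; exists (x * g^-1); rewrite ?rcosetM // groupM ?groupV.
  move/(congr1 (fun A => A :* g)); rewrite rcosetKV => ->.
  by exists (x * g); rewrite ?rcosetM ?groupM.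
split=> [||u|f|u f] /=; try by [exact: injR | exact: mem_rcosetsR].
apply/set0Pn/set0Pn => -[x].
  case/setIP; rewrite !mem_rcoset => ug fg.
  by exists (x * g^-1); apply/setIP.
case/setIP => ux fx; exists (x * g).
by rewrite inE !mem_rcoset mulgK ux.
Qed.

Theorem pentagonal_pair_girth5 : edge_girth_regular X /\ has_girth X 5.
Proof.
split; last exact: coset_graph_girth.
pose through f := #|[set Z in cycles_of_length X 5 | f \in Z]|.
exists #|rcosets G1 G|, (degree X G1), 5, (through G2); split=> //.
- exact: coset_graph_simple.
- move=> _ /rcosetsP[g gG ->]; apply: degree_aut (coset_graph_aut gG) _.
- exact: coset_graph_girth.
move=> _ /rcosetsP[g gG ->]; apply/eqP; rewrite eqn_leq; apply/andP; split.
  have /leq_cycles_through_aut := coset_graph_aut (groupVr gG).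
  by move/(_ 5 (G2 :* g)); rewrite rcosetK.
exact: leq_cycles_through_aut (coset_graph_aut gG) _ _.
Qed.

End CosetGraph.

Section Conjugation.

Set Implicit Arguments.
Unset Strict Implicit.
Import GroupScope.

Lemma pentagonal_pair_conj (gT : finGroupType) (G : {group gT})
    (G1 G2 : {set gT}) t x :
  x \in G -> pentagonal_pair G G1 G2 t ->
  pentagonal_pair G (G1 :^ x) (G2 :^ x) (t ^ x).
Proof.
move=> xG [sG1 sG2 tG2 tG1 tt index meet triangle square pentagon].
split; rewrite ?memJ_conjg //.
- by rewrite -(conjGid xG) conjSg.
- by rewrite -(conjGid xG) conjSg.
- by rewrite -conjMg tt conj1g.
- by move=> _ /imsetP[y yG2 ->]; rewrite -conjMg !memJ_conjg index.
- by move=> _ /imsetP[y yG1 ->]; rewrite -!conjMg !memJ_conjg; apply: meet.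
- move=> _ _ /imsetP[y yG1 ->] /imsetP[z zG1 ->].
  by rewrite -!conjMg !memJ_conjg; apply: triangle.
- move=> _ _ _ /imsetP[y yG1 ->] /imsetP[z zG1 ->] /imsetP[v vG1 ->].
  by rewrite -!conjMg !memJ_conjg; apply: square.
have [y yG1 y5] := pentagon; exists (y ^ x); first by rewrite memJ_conjg.
by rewrite -conjMg -conjXg y5 conj1g.
Qed.

End Conjugation.

Section Suzuki.

Set Implicit Arguments.
Unset Strict Implicit.
Import GroupScope GRing.Theory.
Local Open Scope ring_scope.

Variables (e : nat) (F : finFieldType).
Hypothesis cardF : #|F| = (2 ^ (2 * e + 1))%N.

Local Notation th := (@theta e F).
Local Notation act := (point_action F).

(** * The field automorphism theta *)

Lemma Suzuki_pchar : 2 \in [pchar F].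
Proof. exact: card_finPcharP cardF _. Qed.

(** Characteristic two enters polynomial identities only through this lemma: an
    identity is proved over any commutative ring after adding 2 * k. *)
Lemma eq_mod2 (k x y : F) : x = y + 2 * k -> x = y.
Proof. by rewrite (pcharf0 Suzuki_pchar) mul0r addr0. Qed.

Lemma addr_eq0_char2 (x y : F) : x + y = 0 -> x = y.
Proof. by move/eqP; rewrite addr_eq0 (oppr_pchar2 Suzuki_pchar) => /eqP. Qed.

Lemma sqr_eq1_char2 (x : F) : x ^+ 2 = 1 -> x = 1.
Proof.
move=> x2; apply: addr_eq0_char2; apply/eqP; rewrite -sqrf_eq0; apply/eqP.
by apply: (@eq_mod2 (1 + x)); rewrite sqrrD x2; ring.
Qed.

Lemma thetaD x y : th (x + y) = th x + th y :> F.
Proof. by apply: exprDn_pchar; rewrite pnatX pnatE ?Suzuki_pchar. Qed.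

Lemma thetaM x y : th (x * y) = th x * th y :> F.
Proof. exact: exprMn. Qed.

Lemma thetaX x n : th (x ^+ n) = th x ^+ n :> F.
Proof. exact: exprAC. Qed.

Lemma thetaV x : th x^-1 = (th x)^-1 :> F.
Proof. exact: exprVn. Qed.

Lemma theta1 : th 1 = 1 :> F.
Proof. exact: expr1n. Qed.

Lemma theta0 : th 0 = 0 :> F.
Proof. by rewrite /theta expr0n expn_eq0. Qed.

Lemma theta_eq0 x : (th x == 0 :> F) = (x == 0).
Proof. by rewrite /theta expf_eq0 expn_gt0. Qed.

Lemma theta_theta x : th (th x) = x ^+ 2 :> F.
Proof.
have -> : th (th x) = x ^+ (#|F| * 2)%N.
  rewrite /theta -exprM -expnD cardF -expnSr; congr (_ ^+ (_ ^ _)%N).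
  by rewrite mul2n -addnn addn1 addSn addnS.
by rewrite exprM expf_card.
Qed.

Lemma theta_inj : injective th.
Proof.
move=> x y eq_xy; apply: addr_eq0_char2; apply/eqP.
by rewrite -theta_eq0 thetaD eq_xy (addrr_pchar2 Suzuki_pchar).
Qed.

(** The entries of a torus element involve r = c ^ (2 ^ e); this and [sqr_half]
    express everything about r through theta. *)
Lemma theta_half c : th (c ^+ (2 ^ e)) = c :> F.
Proof.
by rewrite /theta -exprM -expnD -[RHS]expf_card cardF addnS mul2n -addnn addn1.
Qed.

Lemma sqr_half c : (c ^+ (2 ^ e)) ^+ 2 = th c :> F.
Proof. by rewrite /theta -exprM expnS mulnC. Qed.

(** The term of the equation of the ovoid in x alone.  It is multiplicative, and
    x ^ 2 * theta x = 1 gives, by applying theta and taking a square root,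
    x * theta x = 1 and so x = 1: hence it permutes the field. *)
Definition tits_norm (x : F) : F := x ^+ 2 * th x.

Lemma tits_norm_inj : injective tits_norm.
Proof.
have norm0 x : tits_norm x = 0 -> x = 0.
  move/eqP; rewrite /tits_norm mulf_eq0 theta_eq0 expf_eq0 /= orbb.
  by move/eqP.
move=> x y; have [-> | y0] := eqVneq y 0.
  by move=> eq0; apply: norm0; rewrite eq0 /tits_norm expr0n mul0r.
rewrite -[x](divfK y0); move: (x / y) => r eq_ry.
have r1 : r ^+ 2 * th r = 1.
  have ny0 : tits_norm y != 0 by apply: contraNneq y0 => /norm0 ->.
  by apply: (mulIf ny0); rewrite mul1r -[RHS]eq_ry /tits_norm thetaM; ring.
have rth1 : r * th r = 1.
  apply: sqr_eq1_char2; have := congr1 th r1.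
  by rewrite thetaM thetaX theta_theta theta1 exprMn mulrC.
by rewrite -[r]mulr1 -rth1 mulrA -expr2 r1 mul1r.
Qed.

Lemma tits_norm_surj z : exists x, tits_norm x = z.
Proof. by have [g _ gK] := injF_bij tits_norm_inj; exists (g z). Qed.

Lemma theta_surj z : exists x, th x = z :> F.
Proof. by have [g _ gK] := injF_bij theta_inj; exists (g z). Qed.

(** * Matrices of the Suzuki group *)

Lemma rv4P (v w : 'rV[F]_4) :
  v 0 (inord 0) = w 0 (inord 0) -> v 0 (inord 1) = w 0 (inord 1) ->
  v 0 (inord 2) = w 0 (inord 2) -> v 0 (inord 3) = w 0 (inord 3) -> v = w.
Proof.
move=> e0 e1 e2 e3; apply/rowP => j; rewrite -[j]inord_val.
by case: j => [[|[|[|[|//]]]] ?].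
Qed.

Lemma rv4_eta (v : 'rV[F]_4) : exists x0 x1 x2 x3, v = rv4 x0 x1 x2 x3.
Proof.
exists (v 0 (inord 0)), (v 0 (inord 1)), (v 0 (inord 2)), (v 0 (inord 3)).
by apply: rv4P; rewrite mxE inordK.
Qed.

Lemma rv4_inj (x0 x1 x2 x3 y0 y1 y2 y3 : F) :
  rv4 x0 x1 x2 x3 = rv4 y0 y1 y2 y3 -> [/\ x0 = y0, x1 = y1, x2 = y2 & x3 = y3].
Proof.
move/rowP => eq_xy; split;
  [have := eq_xy (inord 0) | have := eq_xy (inord 1)
  | have := eq_xy (inord 2) | have := eq_xy (inord 3)];
  by rewrite !mxE inordK.
Qed.

Lemma rv4_scale (a x0 x1 x2 x3 : F) :
  a *: rv4 x0 x1 x2 x3 = rv4 (a * x0) (a * x1) (a * x2) (a * x3).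
Proof. by apply: rv4P; rewrite !mxE inordK. Qed.

Lemma rv4_mx4 (x0 x1 x2 x3 a0 a1 a2 a3 b0 b1 b2 b3 c0 c1 c2 c3 d0 d1 d2 d3 : F) :
  rv4 x0 x1 x2 x3 *m mx4 [:: [:: a0; a1; a2; a3]; [:: b0; b1; b2; b3];
                             [:: c0; c1; c2; c3]; [:: d0; d1; d2; d3]]
  = rv4 (x0 * a0 + x1 * b0 + x2 * c0 + x3 * d0)
        (x0 * a1 + x1 * b1 + x2 * c1 + x3 * d1)
        (x0 * a2 + x1 * b2 + x2 * c2 + x3 * d2)
        (x0 * a3 + x1 * b3 + x2 * c3 + x3 * d3).
Proof.
by apply: rv4P; rewrite mxE !big_ord_recr big_ord0 !mxE /= inordK // add0r.
Qed.

Lemma mx4_cv4 (x0 x1 x2 x3 a0 a1 a2 a3 b0 b1 b2 b3 c0 c1 c2 c3 d0 d1 d2 d3 : F) :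
  mx4 [:: [:: a0; a1; a2; a3]; [:: b0; b1; b2; b3];
          [:: c0; c1; c2; c3]; [:: d0; d1; d2; d3]] *m (rv4 x0 x1 x2 x3)^T
  = (rv4 (a0 * x0 + a1 * x1 + a2 * x2 + a3 * x3)
         (b0 * x0 + b1 * x1 + b2 * x2 + b3 * x3)
         (c0 * x0 + c1 * x1 + c2 * x2 + c3 * x3)
         (d0 * x0 + d1 * x1 + d2 * x2 + d3 * x3))^T.
Proof.
apply/trmx_inj; rewrite trmxK.
by apply: rv4P; rewrite !mxE !big_ord_recr big_ord0 !mxE /= inordK // add0r.
Qed.

Lemma unipotent_mx_unit a b : suzuki_unipotent e a b \in @unitmx F 4.
Proof.
rewrite unitmxE det_trig; last first.
  by apply/is_trig_mxP => -[[|[|[|[|//]]]] ?] [[|[|[|[|//]]]] ?] //= _; rewrite !mxE.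
by rewrite !big_ord_recr big_ord0 !mxE /= !mulr1 unitr1.
Qed.

Lemma torus_mx_unit c : c != 0 -> suzuki_torus e c \in @unitmx F 4.
Proof.
move=> c0; rewrite unitmxE det_trig; last first.
  by apply/is_trig_mxP => -[[|[|[|[|//]]]] ?] [[|[|[|[|//]]]] ?] //= _; rewrite !mxE.
rewrite !big_ord_recr big_ord0 !mxE /= mul1r unitfE !mulf_neq0 ?invr_eq0 //;
  exact: expf_neq0.
Qed.

Lemma involution_mx_sqr : suzuki_involution F *m suzuki_involution F = 1%:M.
Proof.
apply/row_matrixP => i; rewrite !rowE mulmxA mulmx1.
have [x0 [x1 [x2 [x3 ->]]]] := rv4_eta (delta_mx 0 i).
by rewrite !rv4_mx4; congr rv4; ring.
Qed.

Definition unipotent a b : {'GL_4[F]} :=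
  insubd (1%g : {'GL_4[F]}) (suzuki_unipotent e a b).
Definition torus c : {'GL_4[F]} :=
  insubd (1%g : {'GL_4[F]}) (suzuki_torus e c).
Definition involution : {'GL_4[F]} :=
  insubd (1%g : {'GL_4[F]}) (suzuki_involution F).

Lemma unipotentE a b : GLval (unipotent a b) = suzuki_unipotent e a b.
Proof. by rewrite /unipotent (val_insubd (1%g : {'GL_4[F]})) unipotent_mx_unit. Qed.

Lemma torusE c : c != 0 -> GLval (torus c) = suzuki_torus e c.
Proof.
by move=> c0; rewrite /torus (val_insubd (1%g : {'GL_4[F]})) torus_mx_unit.
Qed.

Lemma involutionE : GLval involution = suzuki_involution F.
Proof.
by rewrite /involution val_insubd; have [_ ->] := mulmx1_unit involution_mx_sqr.
Qed.

Lemma involution_sqr : (involution * involution)%g = 1%g.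
Proof.
apply: val_inj; rewrite -[LHS]/(GLval _).
by rewrite GL_MxE involutionE involution_mx_sqr.
Qed.

Lemma rv4_unipotent a b (x0 x1 x2 x3 : F) :
  rv4 x0 x1 x2 x3 *m GLval (unipotent a b) =
  rv4 (x0 + x1 * a + x2 * b + x3 * (a ^+ 2 * th a + a * b + th b))
      (x1 + x2 * th a + x3 * (a * th a + b)) (x2 + x3 * a) x3.
Proof. by rewrite unipotentE rv4_mx4; congr rv4; ring. Qed.

Lemma rv4_torus c (x0 x1 x2 x3 : F) (r := c ^+ (2 ^ e)) : c != 0 ->
  rv4 x0 x1 x2 x3 *m GLval (torus c) =
  rv4 (x0 * (c * r)) (x1 * r) (x2 / r) (x3 / (c * r)).
Proof.
by move=> c0; rewrite torusE // rv4_mx4 !mulr0 ?addr0 ?add0r exprD expr1 -/r.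
Qed.

Lemma rv4_involution (x0 x1 x2 x3 : F) :
  rv4 x0 x1 x2 x3 *m GLval involution = rv4 x3 x2 x1 x0.
Proof. by rewrite involutionE rv4_mx4; congr rv4; ring. Qed.

Lemma unipotent_Sz a b : unipotent a b \in Sz e F.
Proof.
apply: mem_gen; rewrite inE; apply/orP; left.
by apply/existsP; exists a; apply/existsP; exists b; rewrite unipotentE.
Qed.

Lemma torus_Sz c : c != 0 -> torus c \in Sz e F.
Proof.
move=> c0; apply: mem_gen; rewrite inE; apply/orP; right; apply/orP; left.
by apply/existsP; exists c; rewrite c0 torusE /=.
Qed.

Lemma involution_Sz : involution \in Sz e F.
Proof. by apply: mem_gen; rewrite inE involutionE eqxx !orbT. Qed.

Lemma Sz_ind (P : {'GL_4[F]} -> Prop) :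
  P 1%g ->
  (forall g a b, P g -> P (g * unipotent a b)%g) ->
  (forall g c, c != 0 -> P g -> P (g * torus c)%g) ->
  (forall g, P g -> P (g * involution)%g) ->
  {in Sz e F, forall g, P g}.
Proof.
move=> P1 PU PT Pw g /gen_prodgP[n [c Sc ->]].
elim: n c Sc => [|n IHn] c Sc; first by rewrite big_ord0.
rewrite big_ord_recr /=; set h := (\prod_(i < n) _)%g.
have Ph : P h by apply: IHn => i.
have := Sc ord_max; rewrite inE => /or3P[].
- case/existsP=> a /existsP[b /eqP eq_c].
  by rewrite (_ : c _ = unipotent a b);
    [apply: PU | apply: val_inj; rewrite /= unipotentE].
- case/existsP=> d /andP[d0 /eqP eq_c].
  by rewrite (_ : c _ = torus d); [apply: PT | apply: val_inj; rewrite /= torusE].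
- move/eqP=> eq_c.
  by rewrite (_ : c _ = involution);
    [apply: Pw | apply: val_inj; rewrite /= involutionE].
Qed.

(** The 2 by 2 minors are the Pluecker coordinates of the line spanned by the rows
    x and y.  Four of them are tied to the point x by theta, and [minor03] says
    that the line is totally isotropic for the symplectic form preserved by the
    group. *)
Record suzuki_minors (x0 x1 x2 x3 y0 y1 y2 y3 : F) : Prop := SuzukiMinors {
  minor01 : x0 * y1 - x1 * y0 = th x0;
  minor02 : x0 * y2 - x2 * y0 = th x1;
  minor13 : x1 * y3 - x3 * y1 = th x2;
  minor23 : x2 * y3 - x3 * y2 = th x3;
  minor03 : x0 * y3 - x3 * y0 = x1 * y2 - x2 * y1 }.

Lemma eq_mod2_comb (k l u v x y : F) :
  u = v -> x = y + 2 * k + l * (u - v) -> x = y.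
Proof.
by move=> -> eq_xy; apply: (eq_mod2 (k := k)); rewrite eq_xy subrr mulr0 addr0.
Qed.

(** The first two rows of the identity matrix satisfy the relations, and each
    generator preserves them by right multiplication: the four minors with theta
    transform under the exterior square as the coordinates do after theta. *)
Lemma Sz_minors g : g \in Sz e F -> exists x0 x1 x2 x3 y0 y1 y2 y3 : F,
  [/\ rv4 1 0 0 0 *m GLval g = rv4 x0 x1 x2 x3,
      rv4 0 1 0 0 *m GLval g = rv4 y0 y1 y2 y3
    & suzuki_minors x0 x1 x2 x3 y0 y1 y2 y3].
Proof.
pose minors_of (r s : 'rV[F]_4) :=
  exists x0 x1 x2 x3 y0 y1 y2 y3 : F,
  [/\ r = rv4 x0 x1 x2 x3, s = rv4 y0 y1 y2 y3
    & suzuki_minors x0 x1 x2 x3 y0 y1 y2 y3].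
suff H : {in Sz e F, forall g : {'GL_4[F]},
    minors_of (rv4 1 0 0 0 *m GLval g) (rv4 0 1 0 0 *m GLval g)} by exact: H.
clear g; apply: Sz_ind => [|g a b|g c c0|g]; rewrite /minors_of.
- rewrite GL_1E !mulmx1; do 8!eexists; split=> //.
  by split; rewrite ?theta1 ?theta0; ring.
- case=> x0 [x1 [x2 [x3 [y0 [y1 [y2 [y3 [eq_r eq_s [m01 m02 m13 m23 m03]]]]]]]]].
  rewrite !GL_MxE !mulmxA eq_r eq_s !rv4_unipotent; do 8!eexists; split=> //.
  have thE := (thetaD, thetaM, thetaX, theta_theta).
  split; rewrite ?thE -?m01 -?m02 -?m13 -?m23.
  + pose p12 := x1 * y2 - x2 * y1; pose p13 := x1 * y3 - x3 * y1.
    pose p23 := x2 * y3 - x3 * y2.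
    apply: (eq_mod2_comb (l := a * th a + b) (k := a * th a * p12 - th b * p13
      - (a ^+ 2 * th a ^+ 2 + th a * th b) * p23) m03).
    by rewrite /p12 /p13 /p23; ring.
  + apply: (eq_mod2_comb (l := a) (k := a * (x1 * y2 - x2 * y1)
      - (a ^+ 2 * th a + th b) * (x2 * y3 - x3 * y2)) m03).
    by ring.
  + by ring.
  + by ring.
  + apply: (eq_mod2_comb (l := 1) (k := b * (x2 * y3 - x3 * y2)) m03).
    by ring.
- case=> x0 [x1 [x2 [x3 [y0 [y1 [y2 [y3 [eq_r eq_s [m01 m02 m13 m23 m03]]]]]]]]].
  rewrite !GL_MxE !mulmxA eq_r eq_s !rv4_torus //.
  have := theta_half c; have := sqr_half c.
  have : c ^+ (2 ^ e) != 0 by rewrite expf_neq0.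
  move: (c ^+ (2 ^ e)) => r r0 r2 thr; do 8!eexists; split=> //.
  split; rewrite ?thetaM ?thetaV ?thetaM ?thr -?r2 -?m01 -?m02 -?m13 -?m23.
  1,2,3,4: field; rewrite ?c0 ?r0 //.
  by apply: (eq_mod2_comb (l := 1) (k := 0) m03); field; rewrite ?c0 ?r0.
- case=> x0 [x1 [x2 [x3 [y0 [y1 [y2 [y3 [eq_r eq_s [m01 m02 m13 m23 m03]]]]]]]]].
  rewrite !GL_MxE !mulmxA eq_r eq_s !rv4_involution; do 8!eexists; split=> //.
  split; last by rewrite -opprB m03 opprB.
  1,2,3,4: rewrite -?m01 -?m02 -?m13 -?m23 -[LHS](oppr_pchar2 Suzuki_pchar); ring.
Qed.

(** * The ovoid and its plane sections *)

Local Notation U := unipotent.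
Local Notation T := torus.
Local Notation w := involution.

(** The parametrization of the ovoid used throughout: one point at infinity and
    one point for each pair of field elements. *)
Definition inf_pt : {set 'rV[F]_4} := rowg (rv4 1 0 0 0).
Definition aff_pt x y : {set 'rV[F]_4} :=
  rowg (rv4 (x * y + x ^+ 2 * th x + th y) y x 1).

Lemma ovoidP P :
  reflect (P = inf_pt \/ exists x y, P = aff_pt x y) (P \in ovoid e F).
Proof.
rewrite /ovoid in_setU1; apply: (iffP orP) => -[].
- by move/eqP; left.
- by case/imset2P=> x y _ _ ->; right; exists x, y.
- by move->; left.
- by case=> x [y ->]; right; apply: imset2_f.
Qed.

Lemma GLval_unit (g : {'GL_4[F]}) : GLval g \in unitmx.
Proof. exact: GL_unitmx. Qed.

Lemma act_rowg (v : 'rV[F]_4) (g : {'GL_4[F]}) :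
  act (rowg v) g = rowg (v *m GLval g).
Proof.
apply/setP => u; apply/imsetP/idP => [[x xv ->] | ].
  by rewrite /= mx_repr_actE ?inE // submxMr // -mem_rowg.
rewrite mem_rowg => uv; exists (u *m invmx (GLval g)).
  by rewrite mem_rowg -[v](mulmxK (GLval_unit g)) submxMr.
by rewrite /= mx_repr_actE ?inE // mulmxKV // GLval_unit.
Qed.

Lemma rowg_eqP (v x : 'rV[F]_4) : rowg v = rowg x -> exists a, v = a *: x.
Proof. by move=> eq_vx; apply/sub_rVP; rewrite -rowgS eq_vx. Qed.

Lemma rowg_scale a (v : 'rV[F]_4) : a != 0 -> rowg (a *: v) = rowg v.
Proof.
by move=> a0; apply/setP => u; rewrite !mem_rowg eqmx_scale.
Qed.

Lemma ptK (g : {'GL_4[F]}) P : act (act P g) g^-1%g = P.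
Proof. by apply: actKin; rewrite inE. Qed.

Lemma ptKV (g : {'GL_4[F]}) P : act (act P g^-1%g) g = P.
Proof. by apply: actKVin; rewrite inE. Qed.

Lemma ptM (g h : {'GL_4[F]}) P : act P (g * h)%g = act (act P g) h.
Proof. by apply: actMin; rewrite inE. Qed.

(** Write p for the common value of the two remaining minors.  Expanding a
    3 by 3 determinant with two equal rows gives
    p x3 = theta(x2) x2 - theta(x3) x1, and the quadratic Pluecker relation gives
    p ^ 2 = theta(x0 x3 + x1 x2).  Eliminating p and dividing by x3 leaves, inside
    theta, the equation of the ovoid.  If x3 = 0 the relations collapse to the
    point at infinity. *)
Lemma minors_ovoid x0 x1 x2 x3 y0 y1 y2 y3 :
  suzuki_minors x0 x1 x2 x3 y0 y1 y2 y3 -> rv4 x0 x1 x2 x3 != 0 :> 'rV[F]_4 ->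
  rowg (rv4 x0 x1 x2 x3) \in ovoid e F.
Proof.
case=> m01 m02 m13 m23 m03 nz; apply/ovoidP.
have th_eq0 x : 0 = th x -> x = 0 by move=> /esym/eqP; rewrite theta_eq0 => /eqP.
have [x3_0 | x3_n0] := eqVneq x3 0; [left | right].
  subst x3; rewrite !mul0r !subr0 theta0 in m13 m23 m03.
  have x2_0 : x2 = 0.
    move/eqP: m23; rewrite mulf_eq0 => /orP[/eqP // | /eqP y3_0].
    by apply: th_eq0; rewrite -m13 y3_0 mulr0.
  subst x2; rewrite !mul0r !subr0 theta0 in m02 m13 m03.
  have x1_0 : x1 = 0.
    have [// | x1_n0] := eqVneq x1 0; apply: th_eq0.
    have y3_0 : y3 = 0 by apply: (mulfI x1_n0); rewrite m13 mulr0.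
    have y2_0 : y2 = 0 by apply: (mulfI x1_n0); rewrite -m03 y3_0 !mulr0.
    by rewrite -m02 y2_0 mulr0.
  have x0_n0 : x0 != 0.
    apply: contraNneq nz => x0_0; apply/eqP; rewrite x0_0 x1_0.
    by apply: rv4P; rewrite !mxE inordK.
  by rewrite /inf_pt -(rowg_scale (rv4 1 0 0 0) x0_n0) rv4_scale mulr1 !mulr0 x1_0.
set p := x1 * y2 - x2 * y1 in m03.
have th3_n0 : th x3 != 0 by rewrite theta_eq0.
have eqA : p * x3 = th x2 * x2 - th x3 * x1 by rewrite -m13 -m23 /p; ring.
have eqB : th x0 * th x3 - th x1 * th x2 + p ^+ 2 = 0.
  by rewrite expr2 -{1}m03 -m01 -m02 -m13 -m23 /p; ring.
pose X := x2 / x3; pose Y := x1 / x3; exists X, Y.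
have eqZ : x0 / x3 + X * Y = X ^+ 2 * th X + th Y.
  (* Both sides become (p / theta x3) ^ 2 after applying theta. *)
  apply: theta_inj; transitivity ((th X * X + Y) ^+ 2).
    have -> : th X * X + Y = p / th x3.
      have -> : p = (th x2 * x2 - th x3 * x1) / x3 by rewrite -eqA mulfK.
      apply: (eq_mod2 (k := x1 / x3)).
      by rewrite /X /Y thetaM thetaV; field; rewrite x3_n0.
    rewrite exprMn exprVn.
    have -> : p ^+ 2 = th x1 * th x2 - th x0 * th x3.
      by apply/eqP; rewrite -subr_eq0 -eqB; apply/eqP; ring.
    rewrite /X /Y !(thetaD, thetaM, thetaV).
    apply: (eq_mod2 (k := th x0 / th x3)).
    by field; rewrite th3_n0.
  clearbody X Y; rewrite !(thetaD, thetaM, thetaX, theta_theta).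
  by apply: (eq_mod2 (k := th X * X * Y)); ring.
rewrite /aff_pt -(rowg_scale (rv4 _ _ _ 1) x3_n0) rv4_scale.
congr (rowg (rv4 _ _ _ _)).
- rewrite -addrA -eqZ; apply: (eq_mod2 (k := - (x1 * x2 / x3))).
  by rewrite /X /Y; field.
- by rewrite /Y mulrC divfK.
- by rewrite /X mulrC divfK.
by rewrite mulr1.
Qed.

Lemma GL_row_neq0 (v : 'rV[F]_4) (g : {'GL_4[F]}) : v != 0 -> v *m GLval g != 0.
Proof.
apply: contraNneq => vg0.
by rewrite -(mulmxK (GLval_unit g) v) vg0 mul0mx.
Qed.

Lemma e0_neq0 : rv4 1 0 0 0 != 0 :> 'rV[F]_4.
Proof.
apply/eqP => /matrixP/(_ 0 (inord 0)); rewrite !mxE inordK //= => /eqP.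
by rewrite oner_eq0.
Qed.

Lemma inf_orbit g : g \in Sz e F -> act inf_pt g \in ovoid e F.
Proof.
case/Sz_minors=> x0 [x1 [x2 [x3 [y0 [y1 [y2 [y3 [eq_r _ minors]]]]]]]].
rewrite act_rowg eq_r; apply: minors_ovoid minors _.
by rewrite -eq_r GL_row_neq0 ?e0_neq0.
Qed.

Lemma act_inf_U a b : act inf_pt (U a b) = inf_pt.
Proof.
by rewrite act_rowg rv4_unipotent; congr (rowg (rv4 _ _ _ _)); ring.
Qed.

Lemma act_inf_w : act inf_pt w = aff_pt 0 0.
Proof.
rewrite act_rowg rv4_involution; congr (rowg (rv4 _ _ _ _)).
by rewrite theta0; ring.
Qed.

Lemma act_aff_U x y a b :
  act (aff_pt x y) (U a b) = aff_pt (x + a) (y + x * th a + a * th a + b).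
Proof.
rewrite act_rowg rv4_unipotent; congr (rowg (rv4 _ _ _ _)); try ring.
rewrite !(thetaD, thetaM, thetaX, theta_theta).
apply: (eq_mod2 (k := - (x ^+ 2 * th a + 2 * x * a * th a + a ^+ 2 * th a
  + x * a * th x + a ^+ 2 * th x))).
by ring.
Qed.

(** The involution sends infinity to the origin, and the unipotent elements move
    the origin to any affine point. *)
Lemma aff_orbit x y : exists2 g, g \in Sz e F & aff_pt x y = act inf_pt g.
Proof.
exists (w * U x (y + x * th x))%g.
  by rewrite groupM ?unipotent_Sz ?involution_Sz.
rewrite ptM act_inf_w act_aff_U; congr aff_pt; first by rewrite add0r.
by apply: (eq_mod2 (k := - (x * th x))); ring.
Qed.

Lemma ovoid_orbit P : P \in ovoid e F -> exists2 g, g \in Sz e F & P = act inf_pt g.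
Proof.
case/ovoidP=> [-> | [x [y ->]]]; last exact: aff_orbit.
by exists 1%g; rewrite ?group1 // act_rowg GL_1E mulmx1.
Qed.

Lemma Sz_ovoid P g : g \in Sz e F -> P \in ovoid e F -> act P g \in ovoid e F.
Proof.
move=> gSz /ovoid_orbit[h hSz ->].
by rewrite -ptM inf_orbit ?groupM.
Qed.

(** Planes are given here by the column u of an equation, so that a group element
    acts on them by left multiplication with a matrix. *)
Definition ovoid_section (u : 'cV[F]_4) : {set {set 'rV[F]_4}} :=
  [set P in ovoid e F | [forall v in P, v *m u == 0]].

Lemma mem_section (v : 'rV[F]_4) u :
  (rowg v \in ovoid_section u) = (rowg v \in ovoid e F) && (v *m u == 0).
Proof.
rewrite inE; congr (_ && _); apply/forall_inP/eqP => [vu | vu x].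
  by apply/eqP/vu; rewrite mem_rowg.
by rewrite mem_rowg => /sub_rVP[a ->]; rewrite -scalemxAl vu scaler0.
Qed.

Lemma ovoid_rowg P : P \in ovoid e F -> exists v : 'rV[F]_4, P = rowg v.
Proof. by case/ovoidP=> [|[x [y]]] ->; eexists. Qed.

Lemma section_act u g : g \in Sz e F ->
  setact act (ovoid_section u) g = ovoid_section (invmx (GLval g) *m u).
Proof.
move=> gSz; apply/setP => P; apply/imsetP/idP => [[Q Qu ->] | PC].
  have QO : Q \in ovoid e F by case/setIdP: Qu.
  have [v Qv] := ovoid_rowg QO; rewrite Qv in Qu QO *.
  rewrite act_rowg mem_section -act_rowg Sz_ovoid //= mulmxA.
  by rewrite mulmxK ?GLval_unit //; move: Qu; rewrite mem_section => /andP[].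
exists (act P g^-1%g); last by rewrite ptKV.
have PO : P \in ovoid e F by case/setIdP: PC.
have [v Pv] := ovoid_rowg PO; rewrite Pv in PC PO *.
rewrite act_rowg mem_section -act_rowg Sz_ovoid ?groupV //=.
by move: PC; rewrite mem_section mulmxA => /andP[].
Qed.

Lemma section_scale a u : a != 0 -> ovoid_section (a *: u) = ovoid_section u.
Proof.
move=> a0; apply/setP => P; rewrite !inE; congr (_ && _).
by apply: eq_forallb => v; rewrite -scalemxAr scaler_eq0 (negPf a0).
Qed.

Lemma plane_section_col (W : 'M[F]_4) : \rank W = 3 ->
  exists2 u : 'cV[F]_4, u != 0 & plane_section e W = ovoid_section u.
Proof.
move=> rW; have [j uj] : exists j, col j (cokermx W) != 0.
  apply/existsP; rewrite -negb_forall; apply/negP => /forallP col0.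
  have : \rank (cokermx W) = 1%N by rewrite mxrank_coker rW.
  suff -> : cokermx W = 0 by rewrite mxrank0.
  by apply/matrixP => i k; move/eqP/matrixP: (col0 k) => /(_ i 0); rewrite !mxE.
set u := col j _ in uj; exists u => //.
have sWu : (W <= kermx u)%MS.
  by apply/sub_kermxP; rewrite /u colE mulmxA mulmx_coker mul0mx.
have Wu : (W == kermx u)%MS.
  rewrite -(mxrank_leqif_eq sWu) rW mxrank_ker -mxrank_tr rank_rV.
  by rewrite trmx_eq0 uj.
apply/setP => P; rewrite inE; case PO: (P \in ovoid e F); last by rewrite inE PO.
have [v Pv] := ovoid_rowg PO; rewrite Pv mem_section -Pv PO Pv rowgS.
by rewrite (eqmxP Wu); apply/sub_kermxP/eqP.
Qed.

Lemma cv4_unipotent a b (x0 x1 x2 x3 : F) :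
  GLval (U a b) *m (rv4 x0 x1 x2 x3)^T =
  (rv4 x0 (a * x0 + x1) (b * x0 + th a * x1 + x2)
     ((a ^+ 2 * th a + a * b + th b) * x0 + (a * th a + b) * x1 + a * x2 + x3))^T.
Proof. by rewrite unipotentE mx4_cv4; congr (rv4 _ _ _ _)^T; ring. Qed.

Lemma cv4_involution (x0 x1 x2 x3 : F) :
  GLval w *m (rv4 x0 x1 x2 x3)^T = (rv4 x3 x2 x1 x0)^T.
Proof. by rewrite involutionE mx4_cv4; congr (rv4 _ _ _ _)^T; ring. Qed.

Lemma cv4_eta (u : 'cV[F]_4) : exists x0 x1 x2 x3, u = (rv4 x0 x1 x2 x3)^T.
Proof.
have [x0 [x1 [x2 [x3 eq_u]]]] := rv4_eta u^T.
by exists x0, x1, x2, x3; rewrite -eq_u trmxK.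
Qed.

(** The columns (0,0,s,t) are the planes through the line of the spread at
    infinity.  Every plane contains a line of the spread, which can be moved to
    that one; explicitly, U(a,b) must clear the last two coordinates before w
    reverses them.  When the first coordinate is 1, clearing the third one
    determines b, and the last one becomes an equation for the norm
    [tits_norm] of a + u1, which is solvable. *)
Lemma Sz_col_spread (u : 'cV[F]_4) : exists2 g, g \in Sz e F &
  exists s t, GLval g *m u = (rv4 0 0 s t)^T.
Proof.
have [u0 [u1 [u2 [u3 ->]]]] := cv4_eta u.
have [-> | u0_n0] := eqVneq u0 0.
  have [-> | u1_n0] := eqVneq u1 0.
    by exists 1%g; rewrite ?group1 // GL_1E; exists u2, u3; rewrite mul1mx.
  have [a tha] := theta_surj (- u2 / u1).
  pose b := - (a * th a * u1 + a * u2 + u3) / u1.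
  exists (w * U a b)%g; first by rewrite groupM ?unipotent_Sz ?involution_Sz.
  rewrite GL_MxE -mulmxA cv4_unipotent cv4_involution; exists u1, 0.
  congr (rv4 _ _ _ _)^T; rewrite /b ?tha; by field; rewrite ?u1_n0.
suff [g gSz [s [t eq_g]]] : exists2 g, g \in Sz e F & exists s t,
    GLval g *m (rv4 1 (u1 / u0) (u2 / u0) (u3 / u0))^T = (rv4 0 0 s t)^T.
  exists g => //; exists (u0 * s), (u0 * t).
  have -> : (rv4 u0 u1 u2 u3)^T = u0 *: (rv4 1 (u1 / u0) (u2 / u0) (u3 / u0))^T.
    rewrite -linearZ rv4_scale; congr (rv4 _ _ _ _)^T; by field; rewrite ?u0_n0.
  by rewrite -scalemxAr eq_g -linearZ rv4_scale !mulr0.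
move: (u1 / u0) (u2 / u0) (u3 / u0) => {u0_n0} {}u1 {}u2 {}u3.
have [d normd] := tits_norm_surj (tits_norm u1 + th u2 + u1 * u2 + u3).
pose a := d + u1; pose b := th a * u1 + u2.
exists (w * U a b)%g; first by rewrite groupM ?unipotent_Sz ?involution_Sz.
rewrite GL_MxE -mulmxA cv4_unipotent cv4_involution; exists (a + u1), 1.
congr (rv4 _ _ _ _)^T; rewrite ?mulr1 //.
- have -> : u3 = tits_norm d - tits_norm u1 - th u2 - u1 * u2.
    by rewrite normd; ring.
  rewrite /tits_norm /b /a !(thetaD, thetaM, theta_theta).
  apply: (eq_mod2 (k := (d ^+ 2 + u1 ^+ 2 + d * u1) * th d
    + (d ^+ 2 + d * u1 + u1 ^+ 2) * th u1 + (d + u1) * ((th d + th u1) * u1 + u2))).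
  by ring.
by apply: (eq_mod2 (k := b)); rewrite /b; ring.
Qed.

(** The two cases are a plane that meets the ovoid in a circle, and the tangent
    plane at infinity. *)
Lemma Sz_col_normal (u : 'cV[F]_4) : u != 0 -> exists2 g, g \in Sz e F &
  exists2 s, s != 0 & GLval g *m u = s *: (rv4 0 0 1 0)^T
                   \/ GLval g *m u = s *: (rv4 0 0 0 1)^T.
Proof.
move=> u0; have [g gSz [s [t eq_g]]] := Sz_col_spread u.
have [s0 | s_n0] := eqVneq s 0.
  exists g => //; exists t; last first.
    by right; rewrite eq_g s0 -linearZ rv4_scale !mulr0 mulr1.
  apply: contraNneq u0 => t0; apply/eqP.
  rewrite -(mulKmx (GLval_unit g) u) eq_g s0 t0.
  rewrite (_ : rv4 0 0 0 0 = 0) ?trmx0 ?mulmx0 //.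
  by apply: rv4P; rewrite !mxE inordK.
exists (U (t / s)%R 0%R * g)%g; first by rewrite groupM ?unipotent_Sz.
exists s => //; left; rewrite GL_MxE -mulmxA eq_g cv4_unipotent -linearZ rv4_scale.
congr (rv4 _ _ _ _)^T; rewrite ?mulr0 ?mulr1 ?add0r ?addr0 //.
apply: (eq_mod2 (k := t)); by field; rewrite ?s_n0.
Qed.

Definition base_circle := ovoid_section (rv4 0 0 1 0)^T.

Lemma rv4_dot (x0 x1 x2 x3 y0 y1 y2 y3 : F) :
  (rv4 x0 x1 x2 x3 *m (rv4 y0 y1 y2 y3)^T == 0)
  = (x0 * y0 + x1 * y1 + x2 * y2 + x3 * y3 == 0).
Proof.
apply/eqP/eqP => [/matrixP/(_ 0 0) | dot0].
  by rewrite !mxE !big_ord_recr big_ord0 !mxE /= add0r.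
apply/matrixP => i j; rewrite !ord1 !mxE !big_ord_recr big_ord0 !mxE /=.
by rewrite add0r.
Qed.

Lemma inf_ovoid : inf_pt \in ovoid e F.
Proof. by apply/ovoidP; left. Qed.

Lemma aff_ovoid x y : aff_pt x y \in ovoid e F.
Proof. by apply/ovoidP; right; exists x, y. Qed.

Lemma inf_base_circle : inf_pt \in base_circle.
Proof. by rewrite mem_section inf_ovoid rv4_dot !(mulr0, mul0r, addr0) eqxx. Qed.

Lemma aff_base_circle x y : (aff_pt x y \in base_circle) = (x == 0).
Proof.
by rewrite mem_section aff_ovoid rv4_dot !(mulr0, addr0, add0r, mulr1).
Qed.

Lemma base_circleP P :
  reflect (P = inf_pt \/ exists y, P = aff_pt 0 y) (P \in base_circle).
Proof.
apply: (iffP idP) => [P0 | [-> | [y ->]]]; last 2 first.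
- exact: inf_base_circle.
- by rewrite aff_base_circle.
have /ovoidP[-> | [x [y eq_P]]] : P \in ovoid e F by case/setIdP: P0.
  by left.
by move: P0; rewrite eq_P aff_base_circle => /eqP ->; right; exists y.
Qed.

Lemma circle_normal C : is_circle e C ->
  exists2 g, g \in Sz e F & C = setact act base_circle g.
Proof.
case=> W [rW eqC C_gt1]; have [u u0 eqCu] := plane_section_col rW.
have [g gSz [s s_n0 eq_gu]] := Sz_col_normal u0.
have eqCg : C = setact act (ovoid_section (GLval g *m u)) g.
  by rewrite section_act // mulKmx ?GLval_unit // eqC.
case: eq_gu => eq_gu; rewrite eq_gu section_scale // in eqCg; first by exists g.
suff /subset_leq_card: ovoid_section (rv4 0 0 0 1)^T \subset [set inf_pt].
  by rewrite cards1 leqNgt -(card_setact act _ g) -eqCg C_gt1.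
apply/subsetP => P Pu; have /ovoidP : P \in ovoid e F by case/setIdP: Pu.
case=> [-> | [x [y eq_P]]]; first by rewrite inE.
move: Pu; rewrite eq_P mem_section aff_ovoid rv4_dot !mulr0 !add0r mulr1.
by rewrite oner_eq0.
Qed.

(** * The stabilizer of the base circle *)

Local Notation G1 := (circle_stab e base_circle).

Lemma aff_neq_inf x y : aff_pt x y <> inf_pt.
Proof.
move/esym/rowg_eqP=> [a]; rewrite rv4_scale mulr1 => /rv4_inj[az1 _ _ a0].
by move/eqP: az1; rewrite -a0 mul0r oner_eq0.
Qed.

Lemma aff_inj x y x' y' : aff_pt x y = aff_pt x' y' -> x = x' /\ y = y'.
Proof.
move/rowg_eqP=> [a]; rewrite rv4_scale mulr1 => /rv4_inj[_ eq_y eq_x a1].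
by rewrite eq_x eq_y -a1 !mul1r.
Qed.

Lemma aff0 y : aff_pt 0 y = rowg (rv4 (th y) y 0 1).
Proof. by rewrite /aff_pt mul0r expr0n mul0r !add0r. Qed.

Lemma act_aff_T c x y : c != 0 ->
  act (aff_pt x y) (T c) = aff_pt (c * x) (c * th c * y).
Proof.
move=> c0; have r0 : c ^+ (2 ^ e) != 0 by rewrite expf_neq0.
rewrite act_rowg rv4_torus // -(rowg_scale _ (mulf_neq0 c0 r0)) rv4_scale.
move: (sqr_half c) r0; move: (c ^+ (2 ^ e)) => r r2 r0.
congr (rowg (rv4 _ _ _ _)).
- rewrite !thetaM theta_theta -r2; ring.
- by rewrite -r2; ring.
- by field.
by rewrite mul1r divff // mulf_neq0.
Qed.

Lemma circle_stabP C g :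
  reflect (g \in Sz e F /\ setact act C g = C) (g \in circle_stab e C).
Proof.
rewrite /circle_stab -astab1_set inE.
apply: (iffP andP) => -[gSz]; first by move/astab1P.
move=> gC; split=> //; apply/astab1P=> //.
Qed.

Lemma circle_stab_act C g P :
  g \in circle_stab e C -> (act P g \in C) = (P \in C).
Proof. by case/setIP=> _; apply: astabs_act. Qed.

Lemma section_stab u g : g \in Sz e F ->
  (forall v : 'rV[F]_4, v *m u = 0 -> v *m (GLval g *m u) = 0) ->
  g \in circle_stab e (ovoid_section u).
Proof.
move=> gSz stab; rewrite !in_setI gSz !in_set /=.
apply/subsetP => P Pu; rewrite inE.
have PO : P \in ovoid e F by case/setIdP: Pu.
have [v eq_P] := ovoid_rowg PO; move: Pu PO; rewrite eq_P mem_section.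
case/andP=> _ /eqP vu PO; rewrite act_rowg mem_section -act_rowg.
by rewrite Sz_ovoid // -mulmxA stab /=.
Qed.

(** By [Sz_minors], an element that fixes infinity also fixes the line of the
    spread at infinity. *)
Lemma stab_inf g : g \in Sz e F -> act inf_pt g = inf_pt ->
  exists x0 y0 y1 : F, rv4 1 0 0 0 *m GLval g = rv4 x0 0 0 0 /\
    rv4 0 1 0 0 *m GLval g = rv4 y0 y1 0 0.
Proof.
move=> gSz; rewrite act_rowg => /rowg_eqP[a eq_a].
have [x0 [x1 [x2 [x3 [y0 [y1 [y2 [y3 [eq_r eq_s minors]]]]]]]]] :=
  Sz_minors gSz.
move: eq_a; rewrite eq_r rv4_scale mulr1 mulr0 => /rv4_inj[x0_a x1_0 x2_0 x3_0].
subst x1 x2 x3; have a0 : a != 0.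
  have: rv4 x0 0 0 0 != 0 :> 'rV[F]_4 by rewrite -eq_r GL_row_neq0 ?e0_neq0.
  rewrite x0_a; apply: contraNneq => ->; apply/eqP.
  by apply: rv4P; rewrite !mxE inordK.
have [_ m02 _ _ m03] := minors.
have y2_0 : y2 = 0.
  by apply: (mulfI a0); rewrite -x0_a mulr0 -theta0 -m02 mul0r subr0.
have y3_0 : y3 = 0.
  by apply: (mulfI a0); rewrite -x0_a mulr0; move: m03; rewrite !mul0r !subr0.
by exists x0, y0, y1; rewrite eq_s y2_0 y3_0.
Qed.

(** The plane of the base circle is spanned by the line of the spread at infinity
    and the origin, all of which g fixes. *)
Lemma two_point_stab g : g \in Sz e F -> act inf_pt g = inf_pt ->
  act (aff_pt 0 0) g = aff_pt 0 0 -> g \in G1.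
Proof.
move=> gSz g_inf; rewrite aff0 theta0 act_rowg => /rowg_eqP[a eq3].
have [x0 [y0 [y1 [eq0 eq1]]]] := stab_inf gSz g_inf.
apply: section_stab => // v.
have [v0 [v1 [v2 [v3 ->]]]] := rv4_eta v.
move/eqP; rewrite rv4_dot !mulr0 mulr1 !addr0 !add0r => /eqP ->.
have -> : rv4 v0 v1 0 v3 = v0 *: rv4 1 0 0 0 + v1 *: rv4 0 1 0 0
   + v3 *: rv4 0 0 0 1 :> 'rV[F]_4.
  by apply: rv4P; rewrite !mxE inordK //=; ring.
rewrite mulmxA !mulmxDl -!scalemxAl eq0 eq1 eq3.
rewrite -!scalemxAl.
have -> : rv4 x0 0 0 0 *m (rv4 0 0 1 0)^T = 0 :> 'M[F]_1.
  by apply/eqP; rewrite rv4_dot !(mul0r, mulr0, addr0).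
have -> : rv4 y0 y1 0 0 *m (rv4 0 0 1 0)^T = 0 :> 'M[F]_1.
  by apply/eqP; rewrite rv4_dot !(mul0r, mulr0, addr0).
have -> : rv4 0 0 0 1 *m (rv4 0 0 1 0)^T = 0 :> 'M[F]_1.
  by apply/eqP; rewrite rv4_dot !(mul0r, mulr0, addr0).
by rewrite !scaler0 !addr0.
Qed.

Lemma U0_circle_stab b : U 0 b \in G1.
Proof.
apply: section_stab; rewrite ?unipotent_Sz // => v vu.
rewrite cv4_unipotent theta0 -[RHS]vu; congr (_ *m (rv4 _ _ _ _)^T); ring.
Qed.

Lemma T_circle_stab c : c != 0 -> T c \in G1.
Proof.
move=> c0; apply: section_stab; rewrite ?torus_Sz // => v.
have [v0 [v1 [v2 [v3 ->]]]] := rv4_eta v.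
move/eqP; rewrite rv4_dot !mulr0 mulr1 !addr0 !add0r => /eqP ->.
by apply/eqP; rewrite mulmxA rv4_torus // rv4_dot !(mul0r, mulr0, addr0, add0r).
Qed.

(** That G1 fixes the point at infinity is a hypothesis here; it follows from the
    orbit of the nucleus being a single point. *)
Section Stabilizers.

Hypothesis fixG1 : {in G1, forall g, act inf_pt g = inf_pt}.

Let sG1 g : g \in G1 -> g \in Sz e F. Proof. by case/circle_stabP. Qed.
Let G1V g : g \in G1 -> g^-1%g \in G1. Proof. by rewrite /circle_stab groupV. Qed.
Let G1M g h : g \in G1 -> h \in G1 -> (g * h)%g \in G1.
Proof. exact: groupM. Qed.
Let act_o_w : act (aff_pt 0 0) w = inf_pt.
Proof. by rewrite -act_inf_w -ptM involution_sqr; apply: act1. Qed.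
Let wK P : act (act P w) w = P.
Proof. by rewrite -ptM involution_sqr; apply: act1. Qed.

Lemma G1_act_o g : g \in G1 -> exists b, act (aff_pt 0 0) g = aff_pt 0 b.
Proof.
move=> gG1; have: act (aff_pt 0 0) g \in base_circle.
  by rewrite circle_stab_act // aff_base_circle.
case/base_circleP => // eq_o; case: (@aff_neq_inf 0 0).
by apply: (act_inj act g); rewrite eq_o fixG1.
Qed.

Lemma G1_conj_w g : g \in G1 -> act (aff_pt 0 0) g = aff_pt 0 0 ->
  (w * g * w)%g \in G1.
Proof.
move=> gG1 g_o; apply: two_point_stab.
- by rewrite !groupM ?involution_Sz ?(sG1 gG1).
- by rewrite !ptM act_inf_w g_o.
by rewrite !ptM act_o_w fixG1 // act_inf_w.
Qed.

Lemma G1_conj_wP g : g \in G1 -> (w * g * w)%g \in G1 ->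
  act (aff_pt 0 0) g = aff_pt 0 0.
Proof.
move=> gG1 /fixG1; rewrite !ptM act_inf_w => eq_inf.
by apply: (act_inj act w); rewrite eq_inf act_o_w.
Qed.

Lemma act_aff0_w b : act (aff_pt 0 b) w = rowg (rv4 1 0 b (th b)).
Proof. by rewrite aff0 act_rowg rv4_involution. Qed.

(** Cutting the word after w x w, the images of infinity under the two halves are
    <(1, 0, b, theta b)> and <(theta c, c, 0, 1)>; comparing the third coordinates
    gives b = 0. *)
Lemma G1_triangle x y : x \in G1 -> y \in G1 ->
  (w * x * w * y * w)%g \in G1 -> (w * x * w)%g \in G1.
Proof.
move=> xG1 yG1 /fixG1; rewrite !ptM act_inf_w => eq_inf.
have [b eq_x] := G1_act_o xG1; have [c eq_y] := G1_act_o (G1V yG1).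
have: act (aff_pt 0 b) w = aff_pt 0 c.
  rewrite -eq_x -eq_y -[LHS](ptK y); congr (act _ _).
  by apply: (act_inj act w); rewrite eq_inf act_o_w.
rewrite act_aff0_w aff0 => /rowg_eqP[a].
rewrite rv4_scale => /rv4_inj[_ _ + _]; rewrite mulr0 => b0.
by apply: G1_conj_w; rewrite // eq_x b0.
Qed.

(** The letter y is k U(0,d) with k fixing both infinity and o, and k can be
    absorbed in x.  Cutting the word after w x w y, the images of infinity are
    <(1, 0, b, theta b)> U(0,d) and <(1, 0, c, theta c)>.  The second coordinates
    are d * theta b and 0, so d = 0 or b = 0. *)
Lemma G1_square x y z : x \in G1 -> y \in G1 -> z \in G1 ->
  (w * x * w * y * w * z * w)%g \in G1 ->
  ((w * x * w)%g \in G1) || ((w * y * w)%g \in G1).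
Proof.
move=> xG1 yG1 zG1 /fixG1; rewrite !ptM act_inf_w => eq_inf.
have [c eq_z] := G1_act_o (G1V zG1); have [d eq_y] := G1_act_o yG1.
pose k := (y * (U 0 d)^-1)%g.
have kG1 : k \in G1 by rewrite /k G1M ?G1V ?U0_circle_stab.
have act_oU : act (aff_pt 0 0) (U 0 d) = aff_pt 0 d.
  by rewrite act_aff_U //; congr aff_pt; rewrite ?theta0; ring.
have k_o : act (aff_pt 0 0) k = aff_pt 0 0 by rewrite ptM eq_y -act_oU ptK.
have k'G1 : (w * k * w)%g \in G1 by apply: G1_conj_w.
have [b eq_x] := G1_act_o (G1M xG1 k'G1).
have eq_bc : act (act (aff_pt 0 b) w) (U 0 d) = act (aff_pt 0 c) w.
  rewrite -eq_x -eq_z.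
  have -> : act (act (act (aff_pt 0 0) (x * (w * k * w))%g) w) (U 0 d)
      = act (act (act (aff_pt 0 0) x) w) y.
    rewrite -!ptM; congr (act _ _).
    by rewrite /k !mulgA -(mulgA _ w w) involution_sqr mulg1 mulgKV.
  apply: (act_inj act w); apply: (act_inj act z); apply: (act_inj act w).
  by rewrite eq_inf wK ptKV act_o_w.
move: eq_bc; rewrite !act_aff0_w act_rowg rv4_unipotent => /rowg_eqP[a].
rewrite rv4_scale => /rv4_inj[_ + _ _].
rewrite theta0 !(mulr0, add0r) => /eqP; rewrite mulf_eq0 theta_eq0.
case/orP=> /eqP eq0; apply/orP; [left | right]; apply: G1_conj_w => //.
  clearbody k; apply: (act_inj act (w * k * w)%g); rewrite -ptM eq_x eq0.
  by rewrite !ptM act_o_w fixG1 // act_inf_w.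
by rewrite eq_y eq0.
Qed.

Lemma wU_pow5 : ((w * U 0%R 1%R) ^+ 5 = 1)%g.
Proof.
have act_v (v : 'rV[F]_4) : v *m GLval ((w * U 0%R 1%R) ^+ 5)%g = v.
  have [x0 [x1 [x2 [x3 ->]]]] := rv4_eta v.
  rewrite !expgS expg0 mulg1 !GL_MxE !mulmxA.
  rewrite !(rv4_involution, rv4_unipotent) theta0 theta1.
  (* The values of k are the columns of (M ^ 5 - 1) / 2, where M is the matrix of
     w U(0,1) with entries 0 and 1 read as integers. *)
  congr rv4.
  - by apply: (eq_mod2 (k := 11 * x0 + 8 * x1 + 3 * x2 + 6 * x3)); ring.
  - by apply: (eq_mod2 (k := 8 * x0 + 3 * x1 + 3 * x2 + 3 * x3)); ring.
  - by apply: (eq_mod2 (k := 3 * x0 + 3 * x1 + 2 * x3)); ring.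
  - by apply: (eq_mod2 (k := 6 * x0 + 3 * x1 + 2 * x2 + 2 * x3)); ring.
apply: val_inj; apply/row_matrixP => i; rewrite !rowE -[LHS]/(_ *m GLval _).
by rewrite act_v mulmx1.
Qed.

Lemma base_circle_pentagonal :
  pentagonal_pair (Sz e F) G1 (pair_stab e inf_pt (aff_pt 0 0)) w.
Proof.
have pairP g : setact act [set inf_pt; aff_pt 0 0] g =
    [set act inf_pt g; act (aff_pt 0 0) g].
  by rewrite setactE imsetU1 imset_set1.
have pair_stabP g : g \in pair_stab e inf_pt (aff_pt 0 0) <->
    g \in Sz e F /\
    [set act inf_pt g; act (aff_pt 0 0) g] = [set inf_pt; aff_pt 0 0].
  rewrite /pair_stab -astab1_set inE; split=> [/andP[gSz /astab1P/= eq_g]|].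
    by split; rewrite // -pairP.
  by case=> gSz eq_g; rewrite gSz; apply/astab1P; rewrite ?inE //= pairP.
split.
- exact: subsetIl.
- exact: subsetIl.
- by apply/pair_stabP; rewrite involution_Sz act_inf_w act_o_w setUC.
- apply/negP => /fixG1; rewrite act_inf_w; exact: aff_neq_inf.
- exact: involution_sqr.
- move=> g /pair_stabP[gSz eq_g]; apply/orP.
  have: act (aff_pt 0 0) g \in [set inf_pt; aff_pt 0 0] by rewrite -eq_g set22.
  have: act inf_pt g \in [set inf_pt; aff_pt 0 0] by rewrite -eq_g set21.
  rewrite !in_set2 => /orP[] /eqP g_inf /orP[] /eqP g_o.
  + case: (@aff_neq_inf 0 0); apply: (act_inj act g).
    by rewrite g_o g_inf.
  + by left; apply: two_point_stab.
  + right; apply: two_point_stab; first by rewrite groupM ?involution_Sz.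
      by rewrite ptM g_inf act_o_w.
    by rewrite ptM g_o act_inf_w.
  + case: (@aff_neq_inf 0 0); apply: (act_inj act g).
    by rewrite g_o g_inf.
- move=> g gG1 wgwG1; apply/pair_stabP; split; first exact: sG1.
  by rewrite fixG1 // (G1_conj_wP gG1 wgwG1).
- exact: G1_triangle.
- exact: G1_square.
by exists (U 0 1); [apply: U0_circle_stab | apply: wU_pow5].
Qed.

End Stabilizers.

(** * Normal form of a circle with its nucleus *)

Lemma setwise_stab_conj (S : {set {set 'rV[F]_4}}) h : h \in Sz e F ->
  ('N_(Sz e F)(setact act S h | act) = 'N_(Sz e F)(S | act) :^ h)%g.
Proof.
move=> hSz; rewrite -!astab1_set (astab1_act_in _ S) ?inE //.
by rewrite [RHS]conjIg (conjGid hSz).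
Qed.

Lemma card_orbit_conj (A : {set {'GL_4[F]}}) (h : {'GL_4[F]}) P :
  #|orbit act (A :^ h)%g (act P h)| = #|orbit act A P|.
Proof.
rewrite -(card_setact act (orbit act A P) h); apply: eq_card => Q.
rewrite -[Q](ptKV h) orbit_conjsg_in ?inE ?subsetT //.
by rewrite (mem_imset _ _ (act_inj act h)).
Qed.

Lemma orbit1_fixed (H : {group {'GL_4[F]}}) P :
  #|orbit act H P| = 1%N -> {in H, forall g, act P g = P}.
Proof.
move/eqP/cards1P=> [Q orbP] g gH.
have: act P g \in orbit act H P by apply: mem_orbit.
have: P \in orbit act H P by apply: orbit_refl.
by rewrite orbP !inE => /eqP -> /eqP.
Qed.

(** For b other than 0, the element U(0,b) of G1 translates the affine points, so
    it fixes none of them. *)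
Lemma base_circle_nucleus P : P \in ovoid e F ->
  #|orbit act G1 P| = 1%N -> P = inf_pt.
Proof.
move=> PO /orbit1_fixed/(_ _ (U0_circle_stab 1)).
case/ovoidP: PO => [// | [x [y ->]]]; rewrite act_aff_U => /aff_inj[_ /eqP].
by rewrite theta0 !mulr0 !addr0 -subr_eq0 addrC addKr oner_eq0.
Qed.

(** An affine point (x, y) has all (x, z) in its orbit, which is already q points;
    if x is not 0, the torus moves the first coordinate and the orbit is larger.
    The torus is nontrivial because q > 2. *)
Lemma base_circle_orbit_q p : (0 < e)%N -> p \in ovoid e F ->
  #|orbit act G1 inf_pt| = 1%N -> #|orbit act G1 p| = #|F| ->
  exists y, p = aff_pt 0 y.
Proof.
move=> e_gt0 pO orb_inf orb_p.
have F_gt2 : (2 < #|F|)%N.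
  rewrite cardF (@leq_trans (2 ^ 2)%N) // leq_exp2l // addn1 mul2n -addnn.
  by case: (e) e_gt0.
case/ovoidP: pO orb_p => [-> | [x [y ->]] orb_p].
  by rewrite orb_inf => F1; rewrite -F1 in F_gt2.
have [-> | x_n0] := eqVneq x 0; first by exists y.
have [c c0 c1] : exists2 c : F, c != 0 & c != 1.
  have : ~~ ([set: F] \subset [set 0; 1]).
    apply/negP => /subset_leq_card; rewrite cardsT cards2 leqNgt.
    by rewrite (leq_trans _ F_gt2) //; case: (_ != _).
  by case/subsetPn=> c _; rewrite !inE negb_or => /andP[]; exists c.
have inj_y : injective (aff_pt x) by move=> ? ? /aff_inj[].
have sub_orb : [set aff_pt x z | z : F] \subset orbit act G1 (aff_pt x y).
  apply/subsetP => _ /imsetP[z _ ->].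
  have -> : aff_pt x z = act (aff_pt x y) (U 0 (z - y)).
    by rewrite act_aff_U theta0 !mulr0 !addr0 addrC subrK.
  by apply: mem_orbit; apply: U0_circle_stab.
have eq_orb : [set aff_pt x z | z : F] = orbit act G1 (aff_pt x y).
  by apply/eqP; rewrite eqEcard sub_orb /= orb_p (card_imset _ inj_y).
have: act (aff_pt x y) (T c) \in orbit act G1 (aff_pt x y).
  by apply: mem_orbit; apply: T_circle_stab.
rewrite -eq_orb act_aff_T // => /imsetP[z _ /aff_inj[cx _]].
by case/eqP: c1; apply: (mulIf x_n0); rewrite cx mul1r.
Qed.

Lemma suzuki_flag_normal C n p : (0 < e)%N ->
  is_circle e C -> is_nucleus e C n -> p \in ovoid e F ->
  #|orbit act (circle_stab e C) p| = #|F| ->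
  {in G1, forall g, act inf_pt g = inf_pt} /\
  exists2 h, h \in Sz e F &
    [/\ C = setact act base_circle h, n = act inf_pt h & p = act (aff_pt 0 0) h].
Proof.
move=> e_gt0 circC [nO orb_n] pO orb_p.
have [h hSz eqC] := circle_normal circC.
have hV : (h^-1)%g \in Sz e F by rewrite groupV.
have stabC : circle_stab e C = (G1 :^ h)%g.
  by rewrite eqC /circle_stab setwise_stab_conj.
rewrite stabC -[n](ptKV h) card_orbit_conj in orb_n.
rewrite stabC -[p](ptKV h) card_orbit_conj in orb_p.
have n_inf : act n h^-1%g = inf_pt.
  by apply: base_circle_nucleus orb_n; apply: Sz_ovoid.
rewrite n_inf in orb_n.
have [y p_y] : exists y, act p h^-1%g = aff_pt 0 y.
  by apply: base_circle_orbit_q orb_p; rewrite ?Sz_ovoid.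
split; first exact: orbit1_fixed orb_n.
have UG1 := U0_circle_stab y; have /circle_stabP[USz UC] := UG1.
exists (U 0%R y * h)%g; first by rewrite groupM.
split.
- rewrite actMin ?inE //= UC //.
- by rewrite ptM act_inf_U -n_inf ptKV.
rewrite ptM act_aff_U theta0 !mulr0 !addr0 add0r.
by rewrite -p_y ptKV.
Qed.

End Suzuki.

Theorem theorem3p1 (e : nat) (F : finFieldType)
    (C : {set {set 'rV[F]_4}}) (n p : {set 'rV[F]_4}) :
  1 <= e ->
  #|F| = 2 ^ (2 * e + 1) ->
  is_circle e C ->
  is_nucleus e C n ->
  p \in ovoid e F ->
  #|orbit (point_action F) (circle_stab e C) p| = 2 ^ (2 * e + 1) ->
  edge_girth_regular (suzuki_graph e C n p)
  /\ has_girth (suzuki_graph e C n p) 5.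
Proof.
move=> e_gt0 cardF circC nucC pO orb_p; rewrite -cardF in orb_p.
have [fix_inf [h hSz [eqC eqn eqp]]] :=
  suzuki_flag_normal cardF e_gt0 circC nucC pO orb_p.
have pp := pentagonal_pair_conj hSz (base_circle_pentagonal cardF fix_inf).
have eq_stab : circle_stab e C = (circle_stab e (base_circle e F) :^ h)%g.
  by rewrite eqC /circle_stab setwise_stab_conj.
have eq_pair : pair_stab e n p = (pair_stab e (inf_pt F) (aff_pt e 0%R 0%R) :^ h)%g.
  rewrite /pair_stab -setwise_stab_conj //; congr ('N_(_)(_ | _))%g.
  by rewrite setactE imsetU1 imset_set1 eqn eqp.
rewrite -eq_stab -eq_pair in pp.
exact: (@pentagonal_pair_girth5 _ (Sz e F) ('N_(Sz e F)(C | point_action F))%G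
  ('N_(Sz e F)([set n; p] | point_action F))%G _ pp).
Qed.
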